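(* Let $\mathfrak{T}$ and $\mathfrak{S}$ be $\mathcal{L}$-trees and let $a,b\in T$ and $c,d\in S$ with $a<_{\mathfrak{T}}b$ and $c<_{\mathfrak{S}}d$ be such that $(\mathfrak{T};a)\equiv^{0}(\mathfrak{S};c)$ and $(\mathfrak{T};b)\equiv^{1}(\mathfrak{S};d)$. Then $\left(\mathfrak{T}_{\mathsf{cs}}^{(a,b)};(a,b)\right)\equiv^0\left(\mathfrak{S}_{\mathsf{cs}}^{(c,d)};(c,d)\right)$.
   Context: A tree is a structure $\mathfrak{T}=(T;<)$ with $T$ non-empty and $<$ a strict partial order that is downwards linear (each set $\{x : x \leqslant t\}$ is totally ordered) and downwards connected (for all $s,t$ there is $x$ with $x\leqslant s$ and $x\leqslant t$). The language $\mathcal{L}$ consists of $=$, $<$ and finitely many constants and unary predicates; an $\mathcal{L}$-tree is a tree in this language. $(\mathfrak{T};a)$ and $(\mathfrak{T};A)$ denote expansions by a constant $a$, respectively a unary predicate $A$. $(a,b)=\{x : a<x<b\}$. $\equiv^n$ denotes agreement on all first-order sentences of quantifier rank at most $n$. For $a\in T$ the co-forest of $a$ has underlying set $T_{\mathsf{cf}}^{a}=\{x\in T : a\not<x\text{ and } y<x\text{ for all }y<a\}$. For $a<b$, the open cross section $\mathfrak{T}_{\mathsf{cs}}^{(a,b)}$ is the restriction of $\mathfrak{T}$ to $T_{\mathsf{cs}}^{(a,b)}=\{x\in T : a<x,\ b\not<x,\ x\notin T_{\mathsf{cf}}^{b}\}$. When a tree is restricted to a subset, constants of the language lying outside the subset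 are dropped; $n$-equivalence of two restrictions includes that the same constants are retained in both. Restrictions may be empty. *)

(* Defs.v *)
From mathcomp Require Import all_boot.
From mathcomp Require Import boolp classical_sets.

Set Implicit Arguments.
Unset Strict Implicit.
Unset Printing Implicit Defensive.

Local Open Scope classical_set_scope.

Record language := Language { consts : finType; preds : finType }.

Definition add_const (L : language) :=
  Language (option (consts L)) (preds L).
Definition add_pred (L : language) :=
  Language (consts L) (option (preds L)).

(* [cst] is partial because restricting a structure to a subset drops the
   constants that lie outside it; [cst c = None] means that the symbol [c] has
   been dropped from the language of the structure. The domain may be empty. *)
Record structure (L : language) := Structure {
  dom :> Type;
  slt : dom -> dom -> Prop;
  cst : consts L -> option dom;
  prd : preds L -> set dom }.
Arguments slt {L s} x y.
Arguments cst {L} s c.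
Arguments prd {L} s p.

Definition retained (L : language) (M : structure L) : pred (consts L) :=
  fun c => isSome (cst M c).

(* [term L n] and [formula L n] have their free variables in ['I_n]. A
   quantifier binds the variable [ord0] of its body, and the variable [i] of the
   context appears there as [lift ord0 i]. *)
Inductive term (L : language) (n : nat) : Type :=
| Var of 'I_n
| Cst of consts L.
Arguments Var {L n} i.
Arguments Cst {L n} c.

Inductive formula (L : language) (n : nat) : Type :=
| Bot
| Eq of term L n & term L n
| Lt of term L n & term L n
| Prd of preds L & term L n
| Neg of formula L n
| And of formula L n & formula L n
| Or of formula L n & formula L n
| Imp of formula L n & formula L n
| Ex of formula L n.+1
| All of formula L n.+1.
Arguments Bot {L n}.

Notation sentence L := (formula L 0).

Fixpoint qrank (L : language) (n : nat) (f : formula L n) : nat :=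
  match f with
  | Bot | Eq _ _ | Lt _ _ | Prd _ _ => 0
  | Neg g => qrank g
  | And g h | Or g h | Imp g h => maxn (qrank g) (qrank h)
  | Ex g | All g => (qrank g).+1
  end.

Definition term_over (L : language) (C : pred (consts L)) (n : nat)
    (t : term L n) : bool :=
  if t is Cst c then C c else true.

Fixpoint formula_over (L : language) (C : pred (consts L)) (n : nat)
    (f : formula L n) : bool :=
  match f with
  | Bot => true
  | Eq t u | Lt t u => term_over C t && term_over C u
  | Prd _ t => term_over C t
  | Neg g => formula_over C g
  | And g h | Or g h | Imp g h => formula_over C g && formula_over C h
  | Ex g | All g => formula_over C g
  end.

Definition env_cons (D : Type) (n : nat) (x : D) (e : 'I_n -> D) :
    'I_n.+1 -> D :=
  fun i => oapp e x (unlift ord0 i).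

Definition eval (L : language) (M : structure L) (n : nat) (e : 'I_n -> M)
    (t : term L n) : option M :=
  match t with
  | Var i => Some (e i)
  | Cst c => cst M c
  end.

(* Atomic formulas with a dropped constant get the dummy value [False]; [nequiv]
   only uses sentences over the retained constants. *)
Fixpoint sat (L : language) (M : structure L) (n : nat) (e : 'I_n -> M)
    (f : formula L n) : Prop :=
  match f with
  | Bot => False
  | Eq t u => exists x y, [/\ eval e t = Some x, eval e u = Some y & x = y]
  | Lt t u => exists x y, [/\ eval e t = Some x, eval e u = Some y & slt x y]
  | Prd p t => exists2 x, eval e t = Some x & prd M p x
  | Neg g => ~ sat e g
  | And g h => sat e g /\ sat e h
  | Or g h => sat e g \/ sat e h
  | Imp g h => sat e g -> sat e h
  | Ex g => exists x, sat (env_cons x e) g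
  | All g => forall x, sat (env_cons x e) g
  end.

Definition models (L : language) (M : structure L) (f : sentence L) : Prop :=
  sat (fun i : 'I_0 => False_rect M (notF (ltn_ord i))) f.

Definition nequiv (n : nat) (L : language) (M N : structure L) : Prop :=
  retained M =1 retained N /\
  forall f : sentence L, qrank f <= n -> formula_over (retained M) f ->
    (models M f <-> models N f).

Definition expand_const (L : language) (M : structure L) (a : M) :
    structure (add_const L) :=
  @Structure (add_const L) M (@slt L M) (oapp (cst M) (Some a)) (prd M).

Definition expand_pred (L : language) (M : structure L) (A : set M) :
    structure (add_pred L) :=
  @Structure (add_pred L) M (@slt L M) (cst M) (oapp (prd M) A).

Definition restrict (L : language) (M : structure L) (A : set M) :
    structure L :=
  @Structure L (set_type A)
    (fun x y => slt (val x) (val y))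
    (fun c => obind insub (cst M c))
    (fun p => [set x | prd M p (val x)]).

Definition sle (L : language) (M : structure L) (x y : M) : Prop :=
  slt x y \/ x = y.

Record is_tree (L : language) (T : structure L) : Prop := IsTree {
  tree_nonempty : inhabited T;
  tree_irr : forall x : T, ~ slt x x;
  tree_trans : forall x y z : T, slt x y -> slt y z -> slt x z;
  tree_down_linear : forall t x y : T,
    sle x t -> sle y t -> sle x y \/ sle y x;
  tree_down_connected : forall s t : T, exists x, sle x s /\ sle x t }.

Definition is_Ltree (L : language) (T : structure L) : Prop :=
  is_tree T /\ forall c, retained T c.

Definition interval (L : language) (T : structure L) (a b : T) : set T :=
  [set x | slt a x /\ slt x b].

Definition coforest (L : language) (T : structure L) (a : T) : set T :=
  [set x | ~ slt a x /\ forall y, slt y a -> slt y x].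

Definition cross_section (L : language) (T : structure L) (a b : T) : set T :=
  [set x | [/\ slt a x, ~ slt b x & ~ coforest b x]].

Definition cs_interval (L : language) (T : structure L) (a b : T) :
    structure (add_pred L) :=
  @expand_pred L (restrict (cross_section a b))
    [set x | interval a b (val x)].

(* Main.v *)
(** A constant of [T] with value [x] lies in the cross section of [(a, b)] iff
[a < x], [~ b < x] and some [y < b] satisfies [~ y < x]. The first condition is
quantifier-free in [(T; a)] and the last two have quantifier rank at most [1]
in [(T; b)], so both cross sections retain the same constants. Quantifier-free
sentences only see the atomic relations between constants; those of [<] and of
the unary predicates are inherited, and [a < x < b] is quantifier-free in
[(T; a)] and [(T; b)]. *)
Require Import Defs.
From mathcomp Require Import all_boot.
From mathcomp Require Import boolp classical_sets.

(** The atomic diagram of the constants, stated semantically. Only symbols with a value in both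
    structures are compared, since [cst] is partial. *)
Definition same_diagram {L : language} (M N : structure L) : Prop :=
  forall k l x y x' y',
    cst M k = Some x -> cst M l = Some y ->
    cst N k = Some x' -> cst N l = Some y' ->
    [/\ x = y <-> x' = y', slt x y <-> slt x' y' &
        forall p, prd M p x <-> prd N p x'].

Lemma retained_some {L : language} {M : structure L} {k : consts L} :
  retained M k -> exists x, cst M k = Some x.
Proof. by rewrite /retained; case: (cst M k) => // x _; exists x. Qed.

Lemma some_retained {L : language} {M : structure L} {k : consts L} {x} :
  cst M k = Some x -> retained M k.
Proof. by rewrite /retained => ->. Qed.

Lemma eval_closed {L : language} {M : structure L} {n} (e : 'I_n -> M)
    (t : term L n) :
  n = 0 -> term_over (retained M) t ->
  exists k x, [/\ t = Cst k, cst M k = Some x & eval e t = Some x].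
Proof.
move=> n0; case: t => [i|k] /= Hk.
  by exfalso; move: i; rewrite n0 => -[].
by have [x Hx] := retained_some Hk; exists k, x.
Qed.

(** A quantifier-free sentence is a Boolean combination of atomic sentences about retained
    constants, and the diagram decides these. The equation [n = 0] replaces the type [sentence L]
    because induction on [f] needs a variable index. *)
Lemma sat_same_diagram {L : language} {M N : structure L} n
    (f : formula L n) :
  retained M =1 retained N -> same_diagram M N ->
  n = 0 -> qrank f <= 0 -> formula_over (retained M) f ->
  forall (e : 'I_n -> M) (e' : 'I_n -> N), sat e f <-> sat e' f.
Proof.
move=> hr hd.
have val2 m (t : term L m) e e' : m = 0 -> term_over (retained M) t ->
    exists k x x', [/\ cst M k = Some x, cst N k = Some x',
      eval e t = Some x & eval e' t = Some x'].
  move=> m0 /(eval_closed e t m0)[k [x [-> Hx _]]].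
  have := some_retained Hx; rewrite hr => /retained_some[x' Hx'].
  by exists k, x, x'.
elim: f => {n} n.
- by [].
- move=> t u n0 _ /= /andP[ht hu] e e'.
  have [k [x [x' [kx kx' -> ->]]]] := val2 n t e e' n0 ht.
  have [l [y [y' [ly ly' -> ->]]]] := val2 n u e e' n0 hu.
  have [E _ _] := hd _ _ _ _ _ _ kx ly kx' ly'.
  by split=> -[_ [_ [[<-] [<-] /E H]]]; do 2 eexists.
- move=> t u n0 _ /= /andP[ht hu] e e'.
  have [k [x [x' [kx kx' -> ->]]]] := val2 n t e e' n0 ht.
  have [l [y [y' [ly ly' -> ->]]]] := val2 n u e e' n0 hu.
  have [_ E _] := hd _ _ _ _ _ _ kx ly kx' ly'.
  by split=> -[_ [_ [[<-] [<-] /E H]]]; do 2 eexists.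
- move=> p t n0 _ /= ht e e'.
  have [k [x [x' [kx kx' -> ->]]]] := val2 n t e e' n0 ht.
  have [_ _ E] := hd _ _ _ _ _ _ kx kx kx' kx'.
  by split=> -[_ [<-] /E H]; eexists.
- by move=> g IH n0 qg /= og e e'; rewrite (IH n0 qg og e e').
- move=> g IHg h IHh n0 /=; rewrite geq_max => /andP[qg qh] /andP[og oh] e e'.
  by rewrite (IHg n0 qg og e e') (IHh n0 qh oh e e').
- move=> g IHg h IHh n0 /=; rewrite geq_max => /andP[qg qh] /andP[og oh] e e'.
  by rewrite (IHg n0 qg og e e') (IHh n0 qh oh e e').
- move=> g IHg h IHh n0 /=; rewrite geq_max => /andP[qg qh] /andP[og oh] e e'.
  by rewrite (IHg n0 qg og e e') (IHh n0 qh oh e e').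
(* In the two quantifier cases the bound [qrank f <= 0] is false. *)
- by [].
- by [].
Qed.

(** Atomic sentences have rank 0, so they are among the test sentences for every [n]. *)
Lemma nequiv_same_diagram {n} {L : language} {M N : structure L} :
  nequiv n M N -> same_diagram M N.
Proof.
move=> [hr hf] k l x y x' y' kx ly kx' ly'.
have rk := some_retained kx; have rl := some_retained ly.
split.
- have := hf (Eq (Cst k) (Cst l)) isT; rewrite /= rk rl => /(_ isT).
  rewrite /models /= kx ly kx' ly' => -[H1 H2]; split=> E.
    by have [|_ [_ [[<-] [<-]]]] := H1; first by exists x, y.
  by have [|_ [_ [[<-] [<-]]]] := H2; first by exists x', y'.
- have := hf (Lt (Cst k) (Cst l)) isT; rewrite /= rk rl => /(_ isT).
  rewrite /models /= kx ly kx' ly' => -[H1 H2]; split=> E.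
    by have [|_ [_ [[<-] [<-]]]] := H1; first by exists x, y.
  by have [|_ [_ [[<-] [<-]]]] := H2; first by exists x', y'.
- move=> p; have := hf (Prd p (Cst k)) isT; rewrite /= rk => /(_ isT).
  rewrite /models /= kx kx' => -[H1 H2]; split=> E.
    by have [|_ [<-]] := H1; first by exists x.
  by have [|_ [<-]] := H2; first by exists x'.
Qed.

(** With [k] and [l] naming the two points, the condition is a single existential sentence of rank
    1. *)
Lemma nequiv1_not_below {L : language} {M N : structure L} :
  nequiv 1 M N -> forall k l x y x' y',
  cst M k = Some x -> cst M l = Some y ->
  cst N k = Some x' -> cst N l = Some y' ->
  (exists z, slt z y /\ ~ slt z x) <-> (exists z, slt z y' /\ ~ slt z x').
Proof.
move=> [hr hf] k l x y x' y' kx ly kx' ly'.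
have rk := some_retained kx; have rl := some_retained ly.
pose f : sentence L :=
  Ex (And (Lt (Var ord0) (Cst l)) (Neg (Lt (Var ord0) (Cst k)))).
have fE (P : structure L) u v : cst P k = Some u -> cst P l = Some v ->
    models P f <-> exists z, slt z v /\ ~ slt z u.
  move=> ku lv; rewrite /models /= ku lv /env_cons unlift_none /=.
  split=> -[z [H1 H2]]; exists z; split.
  - by case: H1 => _ [_ [[<-] [<-]]].
  - by move=> H; apply: H2; exists z, u.
  - by exists z, v.
  - by move=> [_ [_ [[<-] [<-]]]].
rewrite -(fE M x y kx ly) -(fE N x' y' kx' ly').
by apply: hf; rewrite //= rk rl.
Qed.

(** Since [~ slt b x] is already the first half of lying in the co-forest of [b], only the second
    half can fail; its negation is existential. *)
Lemma cross_sectionE {L : language} {T : structure L} (a b x : T) :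
  cross_section a b x <->
  [/\ slt a x, ~ slt b x & exists z, slt z b /\ ~ slt z x].
Proof.
split=> -[ax bx H]; split=> //.
  apply: contrapT => nz; apply: H; split=> // z zb.
  by apply: contrapT => zx; apply: nz; exists z.
by case: H => z [zb zx] [_ /(_ z zb)].
Qed.

Lemma cst_cs_interval {L : language} {T : structure L} {a b : T} {k} :
  forall u : cs_interval a b, cst (cs_interval a b) k = Some u ->
  cst T k = Some (val u).
Proof.
move=> u /=; case: (cst T k) => //= x.
by case: insubP => // v _ <- [->].
Qed.

Lemma retained_cs_interval {L : language} {T : structure L} {a b : T} {k x} :
  cst T k = Some x ->
  (retained (cs_interval a b) k : Prop) <-> cross_section a b x.
Proof.
rewrite /retained /= => -> /=.
case: insubP => [v /set_mem H _ //|nH].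
by split=> // /mem_set H; rewrite H in nH.
Qed.

Theorem lemma3p6 (L : language) (T S : structure L)
    (hT : is_Ltree T) (hS : is_Ltree S)
    (a b : T) (c d : S) (hab : slt a b) (hcd : slt c d)
    (hac : nequiv 0 (expand_const a) (expand_const c))
    (hbd : nequiv 1 (expand_const b) (expand_const d)) :
  nequiv 0 (cs_interval a b) (cs_interval c d).
Proof.
have Da := nequiv_same_diagram hac; have Db := nequiv_same_diagram hbd.
(* In the expanded language [None] names the added point and [Some k] the old constant [k]. *)
have ltaE k x x' : cst T k = Some x -> cst S k = Some x' ->
    slt a x <-> slt c x'.
  by move=> kx kx'; have [] := Da None (Some k) a x c x' erefl kx erefl kx'.
have ltbE k x x' : cst T k = Some x -> cst S k = Some x' ->
    slt b x <-> slt d x'.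
  by move=> kx kx'; have [] := Db None (Some k) b x d x' erefl kx erefl kx'.
have cfE k x x' : cst T k = Some x -> cst S k = Some x' ->
    (exists z, slt z b /\ ~ slt z x) <-> (exists z, slt z d /\ ~ slt z x').
  move=> kx kx'.
  exact: (nequiv1_not_below hbd (Some k) None x b x' d kx erefl kx' erefl).
have gtbE k x x' : cst T k = Some x -> cst S k = Some x' ->
    slt x b <-> slt x' d.
  by move=> kx kx'; have [] := Db (Some k) None x b x' d kx erefl kx' erefl.
have hr : retained (cs_interval a b) =1 retained (cs_interval c d).
  move=> k.
  (* In an [L]-tree every constant has a value, so only the restriction can drop one. *)
  have [x kx] := retained_some (hT.2 k); have [x' kx'] := retained_some (hS.2 k).
  have csE : cross_section a b x <-> cross_section c d x'.
    rewrite (propext (cross_sectionE a b x)) (propext (cross_sectionE c d x')).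
    rewrite (propext (ltaE _ _ _ kx kx')) (propext (ltbE _ _ _ kx kx')).
    by rewrite (propext (cfE _ _ _ kx kx')).
  apply/idP/idP => [/(retained_cs_interval kx)/csE|/(retained_cs_interval kx')/csE].
    by move/(retained_cs_interval kx').
  by move/(retained_cs_interval kx).
split=> // f qf of_; apply: sat_same_diagram => //.
move=> k l u v u' v' /cst_cs_interval ku /cst_cs_interval lv
  /cst_cs_interval ku' /cst_cs_interval lv'.
have [E1 E2 E3] := Da (Some k) (Some l) _ _ _ _ ku lv ku' lv'.
split=> //.
  by split=> H; apply: val_inj; apply/E1; rewrite H.
(* The old predicates are inherited; the added one, [None], is the interval. *)
case=> [p|] /=; first exact: E3.
by rewrite /interval /= (ltaE _ _ _ ku ku') (gtbE _ _ _ ku ku').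
Qed.
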